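(* Let $\lambda$ be a nonzero real number. For integers $n\ge 0$ let $(x)_{0,\lambda}=1$ and $(x)_{n,\lambda}=x(x-\lambda)\cdots(x-(n-1)\lambda)$ for $n\ge1$, and let $e_{\lambda}^{x}(t)=\sum_{k\ge0}(x)_{k,\lambda}t^k/k!$, $e_\lambda(t)=e_\lambda^1(t)$. Define the degenerate Bernoulli polynomials $\beta_{n,\lambda}(x)$ by $\frac{t}{e_{\lambda}(t)-1}e_{\lambda}^{x}(t)=\sum_{n=0}^{\infty}\beta_{n,\lambda}(x)\frac{t^{n}}{n!}$ and the degenerate Bernoulli numbers $\beta_{n,\lambda}=\beta_{n,\lambda}(0)$. Define the degenerate Eulerian polynomials $A_{n,\lambda}(x)$ by $\sum_{j=0}^{\infty}(j+1)_{n,\lambda}x^{j}=\frac{A_{n,\lambda}(x)}{(1-x)^{n+1}}$ for $|x|<1$ (these are polynomials in $x$). Then $A_{0,\lambda}(-1)=1$ and, for every positive integer $n$, \[A_{n,\lambda}(-1)=2^{n+1}\,\frac{2^{n+1}\beta_{n+1,\lambda/2}-\beta_{n+1,\lambda}}{n+1}.\]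
   Context: $\beta_{n,\lambda/2}$ denotes the degenerate Bernoulli number with parameter $\lambda/2$ in place of $\lambda$. *)

(* Defs.v *)
From HB Require Import structures.
From mathcomp Require Import all_boot all_order all_algebra.
From mathcomp Require Import all_classical all_reals all_analysis.

Set Implicit Arguments.
Unset Strict Implicit.
Unset Printing Implicit Defensive.

Import Order.TTheory GRing.Theory Num.Theory.
Import numFieldNormedType.Exports.

Local Open Scope classical_set_scope.
Local Open Scope ring_scope.

(* (x)_{n,lam} = x (x - lam) ... (x - (n - 1) lam) *)
Definition degenerate_ffact (R : realType) (lam x : R) (n : nat) : R :=
  \prod_(i < n) (x - i%:R * lam).

(* A formal power series in t is the sequence of its coefficients. The
   pointwise ring structure that the library puts on functions is not the one
   of R[[t]], so the constant 1, the variable and the product are redefined. *)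
Definition fps (R : realType) : Type := nat -> R.

Definition fps_one (R : realType) : fps R := fun k => (k == 0%N)%:R.

Definition fps_var (R : realType) : fps R := fun k => (k == 1%N)%:R.

Definition fps_sub (R : realType) (f g : fps R) : fps R :=
  fun k => f k - g k.

Definition fps_mul (R : realType) (f g : fps R) : fps R :=
  fun k => \sum_(i < k.+1) f i * g (k - i)%N.

(* R[[t]] is an integral domain, so for g nonzero there is at most one such q.
   When g does not divide f the value is the junk series 0. *)
Definition fps_div (R : realType) (f g : fps R) : fps R :=
  xget (fun _ : nat => 0 : R) [set q : nat -> R | fps_mul q g = f].

Definition degenerate_exp (R : realType) (lam x : R) : fps R :=
  fun k => degenerate_ffact lam x k / k`!%:R.

(* n! times the coefficient of t^n in (t / (e_lam(t) - 1)) e_lam^x(t). *)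
Definition degenerate_bernoulli_poly (R : realType) (lam : R) (n : nat) (x : R) : R :=
  n`!%:R *
  fps_mul (fps_div (fps_var R) (fps_sub (degenerate_exp lam 1) (fps_one R)))
          (degenerate_exp lam x) n.

Definition degenerate_bernoulli (R : realType) (lam : R) (n : nat) : R :=
  degenerate_bernoulli_poly lam n 0.

Definition is_degenerate_eulerian (R : realType) (lam : R) (n : nat) (A : {poly R}) :
    Prop :=
  forall x : R, `|x| < 1 ->
    series (fun j : nat => degenerate_ffact lam j.+1%:R n * x ^+ j) @ \oo -->
      A.[x] / (1 - x) ^+ n.+1.

(* The polynomial satisfying is_degenerate_eulerian; it is unique, since a real
   polynomial is determined by its values on the interval ]-1, 1[. *)
Definition degenerate_eulerian (R : realType) (lam : R) (n : nat) : {poly R} :=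
  xget 0 [set A : {poly R} | is_degenerate_eulerian lam n A].

(* Main.v *)
(* Write e for e_lam^1(t) and S_n(x) for the sum of (j+1)_{n,lam} x^j.  Since
   e_lam^{j+2} = e_lam^{j+1} e, the exponential generating function S of the S_n
   satisfies S = e + x S e.  This recursion shows by induction that the series
   converge and that the A_n = (1 - x)^{n+1} S_n are polynomials; at x = -1 it
   says that b, the series with coefficients A_n(-1) / (n! 2^n), satisfies
   b (1 + e) = 2 e.  On the other hand e_{lam/2}(2t) = e^2, so that the Bernoulli
   series B and B' for lam and lam/2 satisfy B(t) (e - 1) = t and
   B'(2t) (e^2 - 1) = 2t.  Multiplying by e^2 - 1, which can be cancelled, gives
   t b = 2t - 2 B(t) + 2 B'(2t), and the theorem compares the coefficients of
   t^{n+1}. *)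

Require Import Defs.
From HB Require Import structures.
From mathcomp Require Import all_boot all_order all_algebra.
From mathcomp Require Import all_classical all_reals all_analysis.
From mathcomp Require Import ring lra.

Set Implicit Arguments.
Unset Strict Implicit.
Unset Printing Implicit Defensive.

Import Order.TTheory GRing.Theory Num.Theory.
Import numFieldNormedType.Exports.

Local Open Scope classical_set_scope.
Local Open Scope ring_scope.

(** * The ring of formal power series *)

(** Truncation reduces identities between coefficients to the ring laws of polynomials, which supply
    commutativity and associativity. *)
Lemma fps_mul_poly (R : realType) (f g : fps R) (m k : nat) : (k < m)%N ->
  fps_mul f g k = ((\poly_(i < m) f i) * (\poly_(i < m) g i))`_k.
Proof.
move=> km; rewrite coefM; apply: eq_bigr => i _; rewrite !coef_poly.
have im : (i < m)%N by apply: leq_ltn_trans km; rewrite -ltnS.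
by rewrite im (leq_ltn_trans (leq_subr _ _) km).
Qed.

Lemma fps_mulC (R : realType) : commutative (@fps_mul R).
Proof.
by move=> f g; apply/funext => k; rewrite !(@fps_mul_poly _ _ _ k.+1) // mulrC.
Qed.

Lemma fps_mulA (R : realType) : associative (@fps_mul R).
Proof.
move=> f g h; apply/funext => k; set tr := fun f : fps R => \poly_(i < k.+1) f i.
transitivity ((tr f * (tr g * tr h))`_k).
  rewrite coefM; apply: eq_bigr => i _; rewrite coef_poly ltn_ord.
  by rewrite (@fps_mul_poly _ _ _ k.+1) // ltnS leq_subr.
rewrite mulrA coefM; apply: eq_bigr => i _.
rewrite coef_poly ltnS leq_subr; congr (_ * _).
by rewrite (@fps_mul_poly _ _ _ k.+1) ?ltn_ord.
Qed.

Lemma fps_mul1 (R : realType) : left_id (@fps_one R) (@fps_mul R).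
Proof.
move=> f; apply/funext => k; rewrite /fps_mul big_ord_recl /fps_one /= mul1r subn0.
by rewrite big1 ?addr0 // => i _; rewrite mul0r.
Qed.

HB.instance Definition _ (R : realType) := GRing.Zmodule.copy (fps R) (nat -> R).

Lemma fps_mulDl (R : realType) : left_distributive (@fps_mul R) +%R.
Proof.
move=> f g h; apply/funext => k; rewrite [RHS]/= /fps_mul.
by rewrite -[RHS]big_split; apply: eq_bigr => i _; rewrite /= mulrDl.
Qed.

Lemma fps_one_neq0 (R : realType) : @fps_one R != 0 :> fps R.
Proof.
by apply/eqP => /(congr1 (fun f : fps R => f 0%N)) /eqP; rewrite /fps_one oner_eq0.
Qed.

HB.instance Definition _ (R : realType) := GRing.Zmodule_isComNzRing.Build (fps R)
  (@fps_mulA R) (@fps_mulC R) (@fps_mul1 R) (@fps_mulDl R) (@fps_one_neq0 R).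

(** * Invertibility, cancellation and rescaling of series *)

Section FormalSeries.
Variable R : realType.
Implicit Types f g h q w : fps R.

Lemma fpsME f g n : (f * g) n = \sum_(i < n.+1) f i * g (n - i)%N.
Proof. by []. Qed.

Lemma fpsDE f g n : (f + g) n = f n + g n.
Proof. by []. Qed.

Lemma fpsNE f n : (- f) n = - f n.
Proof. by []. Qed.

Lemma fps1E n : (1 : fps R) n = (n == 0%N)%:R.
Proof. by []. Qed.

Lemma fps_natME m f n : (m%:R * f) n = m%:R * f n.
Proof.
elim: m => [|m IH]; first by rewrite !mul0r.
by rewrite -!natr1 !mulrDl fpsDE IH !mul1r.
Qed.

Lemma fps_varM0 f : (fps_var R * f : fps R) 0%N = 0.
Proof. by rewrite fpsME big_ord1 mul0r. Qed.

Lemma fps_varMS f n : (fps_var R * f : fps R) n.+1 = f n.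
Proof.
rewrite fpsME !big_ord_recl /fps_var /= mul0r add0r mul1r subSS subn0.
by rewrite big1 ?addr0 // => i _; rewrite mul0r.
Qed.

Lemma fps_var_lreg : GRing.lreg (fps_var R : fps R).
Proof.
by move=> f g fg; apply/funext => n; rewrite -[LHS]fps_varMS fg fps_varMS.
Qed.

Lemma fps_varP f : f 0%N = 0 -> f = fps_var R * (fun n => f n.+1 : R).
Proof.
by move=> f0; apply/funext => -[|n]; rewrite ?fps_varM0 ?fps_varMS.
Qed.

(** As t divides w, t^k divides w^k. *)
Lemma fps_expr_coef_lt w k n : w 0%N = 0 -> (n < k)%N -> (w ^+ k) n = 0.
Proof.
move=> w0; elim: k n => // k IH n; rewrite ltnS => nk.
rewrite exprS (fps_varP w0) -mulrA -(fps_varP w0).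
case: n nk => [|n] nk; first by rewrite fps_varM0.
rewrite fps_varMS fpsME big1 // => i _; rewrite IH ?mulr0 //.
exact: leq_ltn_trans (leq_subr _ _) nk.
Qed.

(* The inverse of 1 - w is the geometric series in w, whose coefficient of t^n
   only involves the powers w^k with k <= n. *)
Lemma fps_invertible g : g 0%N = 1 -> exists h, h * g = 1.
Proof.
move=> g0; set w := 1 - g.
have w0 : w 0%N = 0 by rewrite /w fpsDE fpsNE fps1E g0 subrr.
pose S m := \sum_(k < m) w ^+ k : fps R.
have Sstab m n : (n < m)%N -> S m n = S n.+1 n.
  elim: m => // m IH; rewrite ltnS leq_eqVlt => /predU1P[->//|nm].
  have -> : S m.+1 = S m + w ^+ m by rewrite /S big_ord_recr.
  by rewrite fpsDE IH // fps_expr_coef_lt ?addr0.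
exists (fun n => S n.+1 n : R); apply/funext => n.
transitivity ((S n.+1 * g) n).
  rewrite !fpsME; apply: eq_bigr => i _; congr (_ * _).
  by rewrite (Sstab n.+1) ?ltn_ord.
have -> : S n.+1 * g = 1 - w ^+ n.+1.
  have -> : g = 1 - w by rewrite /w; ring.
  by rewrite -[RHS]opprB subrX1 -/(S n.+1); ring.
by rewrite fpsDE fpsNE fps_expr_coef_lt // subr0.
Qed.

(** Here g = t u with u(0) = 1, and the inverse of u is a quotient of t by g, so [fps_div] does not
    return its junk value. *)
Lemma fps_div_varK g : g 0%N = 0 -> g 1%N = 1 ->
  (fps_div (fps_var R) g : fps R) * g = fps_var R.
Proof.
move=> g0 g1; rewrite /fps_div; case: xgetP => [q _ //|noq].
have [h hK] := @fps_invertible (fun n => g n.+1 : R) g1.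
case: (noq h); change (h * g = fps_var R :> fps R).
by rewrite (fps_varP g0) mulrCA hK mulr1.
Qed.

(** Write g = t u: first t cancels, then u, which is invertible because dividing it by its constant
    term [g 1] gives a series to which [fps_invertible] applies. *)
Lemma fps_lreg g : g 0%N = 0 -> g 1%N != 0 -> GRing.lreg g.
Proof.
move=> g0 g1 f1 f2; rewrite (fps_varP g0) -!mulrA => /fps_var_lreg.
set u : fps R := fun n => _.
have [h hK] := @fps_invertible (fun n => (g 1%N)^-1 * u n : R) (mulVf g1).
have huK : h * (fun n => (g 1%N)^-1 * u n : R) = ((fun n => (g 1%N)^-1 * h n : R) : fps R) * u.
  by apply/funext => n; rewrite !fpsME; apply: eq_bigr => i _; rewrite mulrCA mulrA.
move/(congr1 ( *%R ((fun n => (g 1%N)^-1 * h n : R) : fps R))).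
by rewrite !mulrA -huK hK !mul1r.
Qed.

(** The substitution of ct for t. *)
Definition fps_scale (c : R) f : fps R := fun n => c ^+ n * f n.

Lemma fps_scaleM c f g : fps_scale c (f * g) = fps_scale c f * fps_scale c g.
Proof.
apply/funext => n; rewrite /fps_scale !fpsME mulr_sumr; apply: eq_bigr => i _.
by rewrite mulrACA -exprD subnKC // -ltnS.
Qed.

Lemma fps_scaleB1 c f : fps_scale c (f - 1) = fps_scale c f - 1.
Proof.
apply/funext => n; rewrite /fps_scale !(fpsDE, fpsNE, fps1E) mulrBr.
by case: n => [|n]; rewrite ?mulr0 ?mulr1.
Qed.

Lemma fps_scale_var c : fps_scale c (fps_var R) = fun n => c * fps_var R n.
Proof.
by apply/funext => -[|[|n]]; rewrite /fps_scale /fps_var /= ?expr1 ?mulr0.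
Qed.

End FormalSeries.

(** * Degenerate exponentials and Bernoulli numbers *)

Section DegenerateExp.
Variables (R : realType) (lam : R).

Lemma degenerate_exp0 x : degenerate_exp lam x 0 = 1.
Proof. by rewrite /degenerate_exp /degenerate_ffact big_ord0 divr1. Qed.

Lemma degenerate_exp1 x : degenerate_exp lam x 1 = x.
Proof. by rewrite /degenerate_exp /degenerate_ffact big_ord1 divr1 mul0r subr0. Qed.

(** The differential equation (1 + lam t) f' = x f, read on coefficients. *)
Lemma degenerate_expS x n :
  n.+1%:R * degenerate_exp lam x n.+1 = (x - n%:R * lam) * degenerate_exp lam x n.
Proof.
rewrite /degenerate_exp /degenerate_ffact big_ord_recr /= factS natrM.
have n0 : n.+1%:R != 0 :> R by rewrite pnatr_eq0.
have f0 : n`!%:R != 0 :> R by rewrite pnatr_eq0 -lt0n fact_gt0.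
by move: (n.+1%:R : R) n0 => a a0; field; rewrite a0 f0.
Qed.

(** Both sides have constant term 1 and obey the recurrence [degenerate_expS] for x + y. *)
Lemma degenerate_expD x y : degenerate_exp lam (x + y) =
  (degenerate_exp lam x : fps R) * degenerate_exp lam y.
Proof.
apply/funext; elim=> [|n IH].
  by rewrite fpsME big_ord1 !degenerate_exp0 mulr1.
have n0 : n.+1%:R != 0 :> R by rewrite pnatr_eq0.
apply: (mulfI n0); rewrite degenerate_expS IH !fpsME !mulr_sumr.
set ex := degenerate_exp lam x; set ey := degenerate_exp lam y.
(* Leibniz rule: the factor n + 1 is split as i + (n + 1 - i). *)
transitivity (\sum_(i < n.+2) (i%:R * ex i) * ey (n.+1 - i)%N +
              \sum_(i < n.+2) ex i * ((n.+1 - i)%:R * ey (n.+1 - i)%N)); last first.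
  rewrite -big_split /=; apply: eq_bigr => i _.
  have -> : n.+1%:R = i%:R + (n.+1 - i)%:R :> R.
    by rewrite -natrD subnKC // -ltnS.
  by ring.
rewrite [X in _ = X + _]big_ord_recl /= !mul0r add0r [X in _ = _ + X]big_ord_recr /= subnn.
rewrite !mul0r mulr0 addr0 -big_split /=; apply: eq_bigr => i _.
have ile : (i <= n)%N by rewrite -ltnS.
rewrite /bump add1n degenerate_expS subSS (subSn ile) degenerate_expS natrB //.
by rewrite -/ex -/ey; ring.
Qed.

Lemma degenerate_exp_scale c x : c != 0 ->
  fps_scale c (degenerate_exp (lam / c) x) = degenerate_exp lam (c * x).
Proof.
move=> c0; apply/funext => n; rewrite /fps_scale /degenerate_exp mulrA; congr (_ / _).
rewrite /degenerate_ffact -[in c ^+ n](card_ord n) -prodr_const -big_split /=.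
by apply: eq_bigr => i _; field.
Qed.

Lemma degenerate_bernoulliE n : degenerate_bernoulli lam n =
  n`!%:R * fps_div (fps_var R) ((degenerate_exp lam 1 : fps R) - 1) n.
Proof.
rewrite /degenerate_bernoulli /degenerate_bernoulli_poly; congr (_ * _).
have -> : degenerate_exp lam 0 = @fps_one R.
  apply/funext => -[|k]; first exact: degenerate_exp0.
  by rewrite /degenerate_exp /degenerate_ffact big_ord_recl mul0r subrr mul0r mul0r.
by rewrite fps_mulC fps_mul1.
Qed.

Lemma degenerate_bernoulli_series :
  ((fun n => degenerate_bernoulli lam n / n`!%:R) : fps R) *
    ((degenerate_exp lam 1 : fps R) - 1) = fps_var R.
Proof.
set g := (X in _ * X); rewrite -[RHS](@fps_div_varK R g).
- congr (_ * _); apply/funext => n; rewrite degenerate_bernoulliE -/g mulrC mulKf //.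
- by rewrite /g fpsDE fpsNE degenerate_exp0 subrr.
- by rewrite /g fpsDE fpsNE degenerate_exp1 fps1E subr0.
Qed.

End DegenerateExp.

(** * Convergence of the defining series and the Eulerian polynomials *)

(** The limit is the fixed point of u = x u + l; the distance to it shrinks by the factor |x| at
    each step, up to an error tending to 0. *)
Lemma cvg_affine_rec (R : realType) (x l : R) (u c : nat -> R) : `|x| < 1 ->
  (forall n, u n.+1 = x * u n + c n) -> c @ \oo --> l ->
  u @ \oo --> l / (1 - x).
Proof.
move=> x1 uS cl; have x0 : 1 - x != 0.
  by rewrite subr_eq0 eq_sym; apply: contraTneq x1 => ->; rewrite normr1 ltxx.
pose v n := u n - l / (1 - x).
have vS n : v n.+1 = x * v n + (c n - l) by rewrite /v uS; field.
apply/cvgrPdist_lt => e e0.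
(* This margin makes e / 2 stable: |x| (e / 2) + (1 - |x|) (e / 2) = e / 2. *)
have d0 : 0 < (1 - `|x|) * (e / 2) by rewrite mulr_gt0 ?subr_gt0 ?divr_gt0.
have /cvgrPdist_lt/(_ _ d0)[N _ cN] := cl.
have vle k : `|v (N + k)%N| <= `|x| ^+ k * `|v N| + e / 2.
  elim: k => [|k IH]; first by rewrite addn0 mul1r lerDl ltW ?divr_gt0.
  rewrite addnS vS (le_trans (ler_normD _ _)) // normrM exprS.
  have ck : `|c (N + k)%N - l| < (1 - `|x|) * (e / 2).
    by rewrite distrC; apply: cN => /=; rewrite leq_addr.
  have := ler_wpM2l (normr_ge0 x) IH; move: ck; lra.
have /cvgrPdist_lt/(_ _ (divr_gt0 e0 (ltr0Sn R 1)))[M _ gM] :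
    (fun k => `|x| ^+ k * `|v N|) @ \oo --> (0 : R).
  by rewrite -(mul0r `|v N|); apply: cvgMl; apply: cvg_expr; rewrite normr_id.
exists (N + M)%N => // n /= NMn; rewrite distrC -/(v n).
have Nn : (N <= n)%N by exact: leq_trans (leq_addr _ _) NMn.
have := gM (n - N)%N; rewrite /= leq_subRL // => /(_ NMn).
have := vle (n - N)%N; rewrite subnKC // sub0r normrN.
rewrite [X in X < _]ger0_norm ?mulr_ge0 ?exprn_ge0 //; lra.
Qed.

Section Eulerian.
Variables (R : realType) (lam : R).

Lemma is_degenerate_eulerian_unique n (A B : {poly R}) :
  is_degenerate_eulerian lam n A -> is_degenerate_eulerian lam n B -> A = B.
Proof.
move=> hA hB; apply/eqP; rewrite -subr_eq0; apply/negPn/negP => AB0.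
(* The points 1 / (k + 2) lie in ]0, 1[, and there are too many of them to be roots of a nonzero A -
   B. *)
pose s := [seq (k.+2%:R : R)^-1 | k <- iota 0 (size (A - B))].
have := @max_poly_roots _ (A - B) s AB0; rewrite size_map size_iota ltnn.
move=> /(_ _ _)/wrap[]; last by [].
- apply/allP => _ /mapP[k _ ->]; rewrite /root hornerD hornerN subr_eq0.
  set x := _^-1; have x1 : `|x| < 1.
    by rewrite ger0_norm ?invr_ge0 ?ler0n // invf_lt1 ?ltr0n // ltr1n.
  have x0 : (1 - x) ^+ n.+1 != 0.
    rewrite expf_neq0 // subr_eq0 eq_sym; apply: contraTneq x1 => ->.
    by rewrite normr1 ltxx.
  have lA := cvg_lim (@Rhausdorff R) (hA x x1).
  have lB := cvg_lim (@Rhausdorff R) (hB x x1).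
  by apply/eqP/(mulIf (invr_neq0 x0)); rewrite -lA -lB.
- rewrite map_inj_uniq ?iota_uniq // => i j /invr_inj/eqP.
  by rewrite eqr_nat => /eqP[].
Qed.

Let E := degenerate_exp lam 1.

(* Coefficientwise form of the identity S = e + x S e satisfied by the
   generating function S = e / (1 - x e) of the sums S_n. *)
Definition eulerian_rec (A : nat -> {poly R}) n : {poly R} :=
  n`!%:R *: (E n *: (1 - 'X) ^+ n +
    'X * \sum_(k < n) (E (n - k)%N / k`!%:R) *: ((1 - 'X) ^+ (n - k.+1) * A k)).

(** The partial sums [P n] satisfy an affine recursion with ratio x, whose inhomogeneous term [c]
    involves only [P k] for k < n and converges by hypothesis. *)
Lemma is_degenerate_eulerian_rec A n :
  (forall k, (k < n)%N -> is_degenerate_eulerian lam k (A k)) ->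
  is_degenerate_eulerian lam n (eulerian_rec A n).
Proof.
move=> hA x x1; have x0 : 1 - x != 0.
  by rewrite subr_eq0 eq_sym; apply: contraTneq x1 => ->; rewrite normr1 ltxx.
have fact0 m : m`!%:R != 0 :> R by rewrite pnatr_eq0 -lt0n fact_gt0.
pose P k := series (fun j : nat => degenerate_ffact lam j.+1%:R k * x ^+ j).
pose c N := n`!%:R * (E n + x * \sum_(k < n) (E (n - k)%N / k`!%:R) * P k N).
pose l := n`!%:R * (E n + x * \sum_(k < n) (E (n - k)%N / k`!%:R) *
  ((A k).[x] / (1 - x) ^+ k.+1)).
have -> : (eulerian_rec A n).[x] / (1 - x) ^+ n.+1 = l / (1 - x).
  rewrite /eulerian_rec !hornerE horner_sum /l exprSr invfM mulrA. congr (_ / _).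
  rewrite -[LHS]mulrA mulrDl; congr (_ * (_ + _)).
    by rewrite mulfK // expf_neq0.
  rewrite -mulrA; congr (_ * _); rewrite mulr_suml; apply: eq_bigr => k _.
  rewrite hornerZ hornerM horner_exp !hornerE /=.
  have -> : (1 - x) ^+ n = (1 - x) ^+ (n - k.+1) * (1 - x) ^+ k.+1.
    by rewrite -exprD subnK.
  by field; rewrite !expf_neq0 // fact0.
apply: (@cvg_affine_rec _ x l (P n) c) => //; last first.
  apply: cvgMr; apply: cvgD; first exact: cvg_cst.
  apply: cvgMr; apply: cvg_big => [|k _]; first exact: add_continuous.
   apply: cvgMr; exact: hA.
move=> N; rewrite {1}/P /series /= big_nat_recl //= mulr1.
have ffE j k : degenerate_ffact lam j k = k`!%:R * degenerate_exp lam j k.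
  by rewrite /degenerate_exp mulrC divfK.
(* After the term j = 0 is removed, (j + 2)_{n,lam} is expanded as a convolution: its top term gives
   x [P n], the others give the rest of [c]. *)
under eq_bigr => j _.
  rewrite ffE -natr1 degenerate_expD fpsME big_ord_recr /= subnn degenerate_exp0.
  rewrite mulr1 mulrDr -ffE exprS mulrDl addrC mulrCA.
  over.
rewrite big_split /= -mulr_sumr.
suff -> : c N = degenerate_ffact lam 1 n + \sum_(0 <= j < N) n`!%:R *
  (\sum_(i < n) degenerate_exp lam j.+1%:R i * degenerate_exp lam 1 (n - i)%N) *
  (x * x ^+ j) by rewrite addrCA.
rewrite /c mulrDr ffE; congr (_ + _).
under [RHS]eq_bigr => j _ do rewrite -mulrA mulr_suml.
rewrite -mulr_sumr exchange_big /=; congr (_ * _); rewrite mulr_sumr.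
apply: eq_bigr => k _; rewrite /P /series /= !mulr_sumr; apply: eq_bigr => j _.
by rewrite ffE /E; field; rewrite fact0.
Qed.

(** By strong induction [eulerian_rec] is a witness, so the default 0 of [xget] is never reached. *)
Lemma degenerate_eulerianP n : is_degenerate_eulerian lam n (degenerate_eulerian lam n).
Proof.
elim/ltn_ind: n => n IH; rewrite /degenerate_eulerian.
case: xgetP => [A _ //|noA].
by case: (noA _ (@is_degenerate_eulerian_rec (degenerate_eulerian lam) n IH)).
Qed.

Lemma degenerate_eulerianE n :
  degenerate_eulerian lam n = eulerian_rec (degenerate_eulerian lam) n.
Proof.
apply: (@is_degenerate_eulerian_unique n); first exact: degenerate_eulerianP.
by apply: is_degenerate_eulerian_rec => k _; exact: degenerate_eulerianP.
Qed.

Lemma degenerate_eulerian_N1_series :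
  let b : fps R := fun n => (degenerate_eulerian lam n).[-1] / (n`!%:R * 2 ^+ n) in
  b * (1 + (E : fps R)) = 2%:R * (E : fps R).
Proof.
move=> b; apply/funext => n; rewrite mulrDr mulr1 fpsDE fps_natME fpsME big_ord_recr /=.
rewrite subnn /E degenerate_exp0 mulr1 -/E.
have fact0 m : m`!%:R != 0 :> R by rewrite pnatr_eq0 -lt0n fact_gt0.
have two0 : 2 != 0 :> R by rewrite pnatr_eq0.
(* This is the recursion at x = -1, where 1 - x = 2, divided by n! 2^n; the factor 1/2 is left
   because 2^(n-k-1) 2^k = 2^n / 2. *)
have -> : b n = E n - 2^-1 * \sum_(k < n) b k * E (n - k)%N.
  rewrite {1}/b degenerate_eulerianE /eulerian_rec.
  rewrite hornerZ hornerD hornerM !hornerZ horner_exp horner_sum !hornerE opprK.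
  have -> : \sum_(k < n) ((E (n - k)%N / k`!%:R) *:
      ((1 - 'X) ^+ (n - k.+1) * degenerate_eulerian lam k)).[-1] =
      2 ^+ n * (2^-1 * \sum_(k < n) b k * E (n - k)%N).
    rewrite !mulr_sumr; apply: eq_bigr => k _.
    rewrite /b hornerZ hornerM horner_exp; move: (E _) => e.
    rewrite !hornerE opprK /=.
    have -> : 2 ^+ n = 2 ^+ (n - k.+1) * 2 ^+ k * 2 :> R.
      by rewrite -mulrA -exprSr -exprD subnK.
    have -> : 1 + 1 = 2 :> R by [].
    by field; rewrite fact0 expf_neq0.
  have -> : 1 + 1 = 2 :> R by [].
  by move: (\sum_(k < n) _) => s; field; rewrite fact0 expf_neq0.
by field.
Qed.

End Eulerian.

Theorem theorem2p4 (R : realType) (lam : R) (hlam : lam != 0) :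
  (degenerate_eulerian lam 0).[-1] = 1 /\
  forall n : nat, (0 < n)%N ->
    (degenerate_eulerian lam n).[-1] =
      2 ^+ n.+1 *
      ((2 ^+ n.+1 * degenerate_bernoulli (lam / 2) n.+1 - degenerate_bernoulli lam n.+1)
       / n.+1%:R).
Proof.
have two0 : 2 != 0 :> R by rewrite pnatr_eq0.
have fact0 m : m`!%:R != 0 :> R by rewrite pnatr_eq0 -lt0n fact_gt0.
split.
  rewrite degenerate_eulerianE /eulerian_rec big_ord0 mulr0 addr0 expr0 !hornerE.
  by rewrite degenerate_exp0.
move=> n n0; set E : fps R := degenerate_exp lam 1.
pose b : fps R := fun n => (degenerate_eulerian lam n).[-1] / (n`!%:R * 2 ^+ n).
pose B mu : fps R := fun n => degenerate_bernoulli mu n / n`!%:R.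
have bE : b * (1 + E) = 2%:R * E := degenerate_eulerian_N1_series lam.
have BE : B lam * (E - 1) = fps_var R := degenerate_bernoulli_series lam.
have B2E : fps_scale 2 (B (lam / 2)) * (E * E - 1) = 2%:R * fps_var R.
  have := congr1 (fps_scale 2) (degenerate_bernoulli_series (lam / 2)).
  rewrite fps_scaleM fps_scaleB1 degenerate_exp_scale // mulr1 -[2]/(1 + 1).
  rewrite degenerate_expD => ->; rewrite fps_scale_var.
  by apply/funext => k; rewrite fps_natME.
have key : fps_var R * b =
    2%:R * fps_var R - 2%:R * B lam + 2%:R * fps_scale 2 (B (lam / 2)).
  have EE0 : (E * E - 1 : fps R) 0%N = 0.
    by rewrite -degenerate_expD fpsDE fpsNE degenerate_exp0 subrr.
  have EE1 : (E * E - 1 : fps R) 1%N != 0.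
    by rewrite -degenerate_expD fpsDE fpsNE degenerate_exp1 fps1E subr0.
  (* E^2 - 1 starts with 2t, hence can be cancelled; factoring it as (E - 1)(E + 1) brings in the
     three relations. *)
  apply: (fps_lreg EE0 EE1).
  transitivity (fps_var R * (b * (1 + E)) * (E - 1)); first by ring.
  transitivity (2%:R * fps_var R * (E * E - 1) - 2%:R * (B lam * (E - 1)) * (E + 1) +
    2%:R * (fps_scale 2 (B (lam / 2)) * (E * E - 1))); last by ring.
  by rewrite bE BE B2E; ring.
have := congr1 (fun f : fps R => f n.+1) key.
rewrite fps_varMS !fpsDE fpsNE !fps_natME /b /fps_scale /B /fps_var.
(* Since n > 0, the term 2t does not reach the coefficient of t^(n+1). *)
rewrite eqSS (gtn_eqF n0) mulr0 add0r => /(canRL (mulfVK _)) ->; last first.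
  by rewrite mulf_neq0 ?expf_neq0.
rewrite factS natrM exprS.
have nS : n.+1%:R != 0 :> R by rewrite pnatr_eq0.
move: (n.+1%:R : R) nS => a a0; field.
by rewrite fact0 a0.
Qed.
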